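(* Let $\mathcal{K}$ be a cartesian closed $\infty$-cosmos, let $f\colon A\to E$ be a functor, and let $!\colon A\to 1$ be the unique functor. Any limit of $f$, given by a point $\ell\colon 1\to E$ and a 2-cell $\nu\colon E^{!}\ell\Rightarrow f\colon 1\to E^A$ that is an absolute right lifting diagram, defines (by transposing $\nu$) a pointwise right Kan extension $\nu\colon \ell\,!\Rightarrow f\colon A\to E$ of $f$ along $!\colon A\to 1$. Conversely, any pointwise right Kan extension of this form transposes to define a limit of $f$ in $E$.
   Context: An $\infty$-cosmos (with all objects cofibrant) is a simplicially enriched category $\mathcal{K}$ whose mapping spaces $\mathrm{map}(A,B)$ are quasi-categories, equipped with a subcategory of isofibrations (written $\twoheadrightarrow$), such that: (a) $\mathcal{K}$ has, in the simplicially enriched sense, a terminal object $1$, cotensors $U\pitchfork A$ of every object $A$ by every finitely presented simplicial set $U$, and pullbacks of isofibrations along arbitrary morphisms (''simplicial pullbacks''); (b) isofibrations include all isomorphisms and all maps $A\to 1$, are stable under pullback, for every isofibration $p\colon E\twoheadrightarrow B$ and inclusion $U\hookrightarrow V$ of finitely presented simplicial sets the induced map $V\pitchfork E\to (U\pitchfork E)\times_{U\pitchfork B}(V\pitchfork B)$ is an isofibration, and $\mathrm{map}(X,p)$ is an isofibration of quasi-categories for every object $X$; (c) every object has the left lifting property with respect to trivial fibrations. Here $f$ is an equivalence if $\mathrm{map}(X,f)$ is an equivalence of quasi-categories for all $X$, and a trivial fibration if it is an isofibration and an equivalence. Objects of $\mathcal{K}$ are called $\infty$-categories and its morphisms functors.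 The homotopy 2-category $\mathcal{K}_2$ has the same objects and 1-cells, with $\hom(A,B)$ the homotopy category of $\mathrm{map}(A,B)$. $\mathcal{K}$ is cartesian closed if the binary product extends to a simplicially enriched two-variable adjunction $\mathrm{map}(A\times B,C)\cong\mathrm{map}(A,C^B)\cong\mathrm{map}(B,C^A)$; then $\mathcal{K}_2$ is a cartesian closed 2-category. For $k\colon A\to B$, $E^k\colon E^B\to E^A$ is precomposition with $k$. A functor $f\colon A\to E$ is identified with its transpose $f\colon 1\to E^A$, and $E^{!}\colon E\to E^A$ is the constant diagram functor. Limits. In a 2-category, a 2-cell $\nu\colon ur\Rightarrow f$ with $u\colon P\to Q$, $f\colon K\to Q$, $r\colon K\to P$ is an absolute right lifting diagram if for every object $X$, all 1-cells $p\colon X\to K$, $q\colon X\to P$, and every 2-cell $\chi\colon uq\Rightarrow fp$ there is a unique 2-cell $\zeta\colon q\Rightarrow rp$ with $\chi=\nu p\cdot u\zeta$. A limit of $f\colon A\to E$ is a point $\ell\colon 1\to E$ with an absolute right lifting diagram $\nu\colon E^{!}\ell\Rightarrow f$ in $\mathcal{K}_2$. Comma squares. For functors $f\colon B\to A$, $g\colon C\to A$, the comma $\infty$-category $f\downarrow g$ is the simplicial pullback of $(p_1,p_0)\colon\Delta^1\pitchfork A\twoheadrightarrow A\times A$ (evaluation at $1$ and $0$) along $g\times f\colon C\times B\to A\times A$, with projections $p_1\colon f\downarrow g\to C$, $p_0\colon f\downarrow g\to B$ and canonical 2-cell $\phi\colon fp_0\Rightarrow gp_1$ in $\mathcal{K}_2$;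 this square is called a comma square. Pointwise right Kan extensions. In a 2-category, $\mu\colon rk\Rightarrow f$ (with $k\colon A\to B$, $f\colon A\to C$, $r\colon B\to C$) is a right extension of $f$ along $k$ if for every $e\colon B\to C$ the map sending $\beta\colon e\Rightarrow r$ to $\mu\cdot\beta k\colon ek\Rightarrow f$ is a bijection. It is stable under pasting with a square $\lambda\colon bh\Rightarrow kg$ (with $h\colon D\to E$, $g\colon D\to A$, $b\colon E\to B$) if $\mu g\cdot r\lambda\colon rbh\Rightarrow fg$ displays $rb$ as a right extension of $fg$ along $h$. A pointwise right Kan extension is a right extension in $\mathcal{K}_2$ that is stable under pasting with all comma squares (of the form $\lambda\colon bh\Rightarrow kg$ with $D=b\downarrow k$). *)

(* Defs.v *)
From mathcomp Require Import all_boot boolp.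

Set Implicit Arguments.
Unset Strict Implicit.
Unset Printing Implicit Defensive.

Local Open Scope quotient_scope.

(* [op m n] is the set of monotone maps [m] -> [n], where [n] = {0 < ... < n}. *)
Definition monotone m n (f : {ffun 'I_m.+1 -> 'I_n.+1}) : bool :=
  [forall i : 'I_m.+1, forall j : 'I_m.+1, (i <= j) ==> (f i <= f j)].

Definition op m n := {f : {ffun 'I_m.+1 -> 'I_n.+1} | monotone f}.

Definition opfun m n (a : op m n) : 'I_m.+1 -> 'I_n.+1 := val a.
Coercion opfun : op >-> Funclass.

Lemma opP m n (a : op m n) (i j : 'I_m.+1) : i <= j -> a i <= a j.
Proof. by move: (valP a) => /forallP/(_ i)/forallP/(_ j)/implyP. Qed.

Lemma monotone_ffun m n (f : 'I_m.+1 -> 'I_n.+1) :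
  (forall i j : 'I_m.+1, i <= j -> f i <= f j) -> monotone (finfun f).
Proof.
by move=> fP; apply/'forall_forallP => i j; apply/implyP; rewrite !ffunE; exact: fP.
Qed.

Definition mkop m n (f : 'I_m.+1 -> 'I_n.+1)
    (fP : forall i j : 'I_m.+1, i <= j -> f i <= f j) : op m n :=
  exist _ (finfun f) (monotone_ffun fP).

Definition op_id n : op n n := mkop (fun i j (h : i <= j) => h).

Definition op_comp l m n (b : op m n) (a : op l m) : op l n :=
  mkop (fun i j h => opP b (opP a h)).

Definition op_const m n (k : 'I_n.+1) : op m n :=
  mkop (fun i j _ => leqnn k).

Lemma lift_mono n (k : 'I_n.+2) (i j : 'I_n.+1) : i <= j -> lift k i <= lift k j.
Proof. by rewrite /= leq_bump2. Qed.

(* The injection [n] -> [n+1] whose image omits [k]. *)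
Definition coface n (k : 'I_n.+2) : op n n.+1 := mkop (@lift_mono n k).

Lemma op_eq m n (a b : op m n) : (forall i, a i = b i) -> a = b.
Proof. by move=> ab; apply/val_inj/ffunP. Qed.

Lemma op_compE l m n (b : op m n) (a : op l m) i : op_comp b a i = b (a i).
Proof. by rewrite [LHS]/opfun /= ffunE. Qed.

Lemma op_idE n i : op_id n i = i.
Proof. by rewrite /opfun /= ffunE. Qed.

Lemma op_constE m n k i : @op_const m n k i = k.
Proof. by rewrite /opfun /= ffunE. Qed.

Lemma op_comp1f m n (a : op m n) : op_comp (op_id n) a = a.
Proof. by apply: op_eq => i; rewrite op_compE op_idE. Qed.

Lemma op_compf1 m n (a : op m n) : op_comp a (op_id m) = a.
Proof. by apply: op_eq => i; rewrite op_compE op_idE. Qed.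

Lemma op_compA k l m n (c : op m n) (b : op l m) (a : op k l) :
  op_comp c (op_comp b a) = op_comp (op_comp c b) a.
Proof. by apply: op_eq => i; rewrite !op_compE. Qed.

Record sset := SSet {
  simplex :> nat -> Type;
  act : forall m n, op m n -> simplex n -> simplex m;
  act_id : forall n (x : simplex n), act (op_id n) x = x;
  act_comp : forall l m n (b : op m n) (a : op l m) (x : simplex n),
    act (op_comp b a) x = act a (act b x) }.

Arguments act {s m n}.

Record smap (X Y : sset) := SMap {
  sfun :> forall n, X n -> Y n;
  smap_act : forall m n (a : op m n) (x : X n), sfun (act a x) = act a (sfun x) }.

Arguments sfun {X Y} s {n}.

Definition s_id (X : sset) : smap X X :=
  @SMap X X (fun _ x => x) (fun _ _ _ _ => erefl).

Lemma s_comp_act (X Y Z : sset) (G : smap Y Z) (F : smap X Y) m n (a : op m n) x :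
  G m (F m (act a x)) = act a (G n (F n x)).
Proof. by rewrite !smap_act. Qed.

Definition s_comp (X Y Z : sset) (G : smap Y Z) (F : smap X Y) : smap X Z :=
  @SMap X Z (fun n x => G n (F n x)) (s_comp_act G F).

Record siso (X Y : sset) := SIso {
  sfwd :> smap X Y;
  sbwd : smap Y X;
  sfwdK : forall n (x : X n), sbwd n (sfwd n x) = x;
  sbwdK : forall n (y : Y n), sfwd n (sbwd n y) = y }.

Definition mono (X Y : sset) (F : smap X Y) : Prop := forall n, injective (F n).

Definition sprod (X Y : sset) : sset.
Proof.
refine (@SSet (fun n => X n * Y n)%type
              (fun m n a xy => (act a xy.1, act a xy.2)) _ _).
- by move=> n [x y]; rewrite /= !act_id.
- by move=> l m n b a [x y]; rewrite /= !act_comp.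
Defined.

Definition Delta (n : nat) : sset :=
  @SSet (fun m => op m n) (fun l m a b => op_comp b a)
        (fun m b => op_compf1 b) (fun k l m b a c => op_compA c b a).

(* [in_horn k a]: the simplex [a] of [Delta n] lies in a face opposite to a
   vertex other than [k]. *)
Definition in_horn n (k : 'I_n.+1) m (a : op m n) : bool :=
  [exists j, (j != k) && [forall i, a i != j]].

Lemma in_horn_comp n (k : 'I_n.+1) l m (b : op m n) (a : op l m) :
  in_horn k b -> in_horn k (op_comp b a).
Proof.
move=> /existsP[j /andP[jk /forallP bj]]; apply/existsP; exists j.
by rewrite jk /=; apply/forallP => i; rewrite op_compE bj.
Qed.

Definition horn n (k : 'I_n.+1) : sset.
Proof.
refine (@SSet (fun m => {a : op m n | in_horn k a})
  (fun l m a b => exist _ (op_comp (val b) a) (in_horn_comp a (valP b))) _ _).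
- by move=> m b; apply: val_inj; exact: op_compf1.
- by move=> j l m b a c; apply: val_inj; exact: op_compA.
Defined.

Definition quasicategory (X : sset) : Prop :=
  forall n (k : 'I_n.+1) (h : smap (horn k) X), 0 < k < n ->
  exists x : X n, forall m (a : horn k m), act (val a) x = h m a.

(* [Iso n]: the [n]-simplices of the nerve of the groupoid freely generated by
   one isomorphism, whose objects are [false] and [true] and which has exactly
   one morphism between any two objects. *)
Definition Iso : sset.
Proof.
refine (@SSet (fun n => {ffun 'I_n.+1 -> bool})
              (fun m n a x => [ffun i => x (a i)]) _ _).
- by move=> n x; apply/ffunP => i; rewrite ffunE op_idE.
- by move=> l m n b a x; apply/ffunP => i; rewrite !ffunE op_compE.
Defined.

Definition Iso_pt (b : bool) n : Iso n := [ffun => b].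

(* Isofibrations between quasi-categories: the right lifting property against
   the inner horn inclusions and against the inclusion of an object in [Iso]. *)
Definition qcat_isofibration (X Y : sset) (p : smap X Y) : Prop :=
  (forall n (k : 'I_n.+1) (h : smap (horn k) X) (y : Y n), 0 < k < n ->
     (forall m (a : horn k m), p m (h m a) = act (val a) y) ->
     exists x : X n, p n x = y /\
       forall m (a : horn k m), act (val a) x = h m a) /\
  (forall (x : X 0) (j : smap Iso Y), j 0 (Iso_pt false 0) = p 0 x ->
     exists i : smap Iso X, i 0 (Iso_pt false 0) = x /\
       forall n (z : Iso n), p n (i n z) = j n z).

Definition Iso_homotopic (X Y : sset) (F G : smap X Y) : Prop :=
  exists H : smap (sprod X Iso) Y, forall n (x : X n),
    H n (x, Iso_pt false n) = F n x /\ H n (x, Iso_pt true n) = G n x.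

Definition qcat_equivalence (X Y : sset) (F : smap X Y) : Prop :=
  exists G : smap Y X,
    Iso_homotopic (s_id X) (s_comp G F) /\ Iso_homotopic (s_comp F G) (s_id Y).

(* [U] has a presentation by finitely many generating simplices [x i], subject
   to finitely many relations [act (a j) (x (s j)) = act (b j) (x (t j))];
   equivalently, finitely many simplices of [U] are nondegenerate. *)
Definition finitely_presented (U : sset) : Prop :=
  exists (k : nat) (d : 'I_k -> nat) (x : forall i, U (d i))
         (l : nat) (c : 'I_l -> nat) (s t : 'I_l -> 'I_k)
         (a : forall j, op (c j) (d (s j))) (b : forall j, op (c j) (d (t j))),
    (forall j, act (a j) (x (s j)) = act (b j) (x (t j))) /\
    forall (Y : sset) (y : forall i, Y (d i)),
      (forall j, act (a j) (y (s j)) = act (b j) (y (t j))) ->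
      exists! h : smap U Y, forall i, h (d i) (x i) = y i.

Definition degen (X : sset) n (x : X 0) : X n := act (@op_const n 0 ord0) x.

Definition src (X : sset) (e : X 1) : X 0 := act (coface ord_max) e.
Definition tgt (X : sset) (e : X 1) : X 0 := act (coface ord0) e.

Definition edge (X : sset) (x y : X 0) := {e : X 1 | src e = x /\ tgt e = y}.

Inductive hpath (X : sset) : X 0 -> X 0 -> Type :=
| pnil x : hpath x x
| pcons x y z : edge x y -> hpath y z -> hpath x z.

Fixpoint pcat (X : sset) (x y z : X 0) (p : hpath x y) : hpath y z -> hpath x z :=
  match p in hpath x y return hpath y z -> hpath x z with
  | pnil _ => fun q => q
  | pcons _ _ _ e p' => fun q => pcons e (pcat p' q)
  end.

(* The congruence on the free category on the graph of edges of [X] generated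
   by: degenerate edges are identities, and [d_1 t = d_0 t o d_2 t] for every
   2-simplex [t].  Paths are composed in diagrammatic order. *)
Inductive hrel (X : sset) : forall x y : X 0, hpath x y -> hpath x y -> Prop :=
| hrel_refl x y (p : hpath x y) : hrel p p
| hrel_sym x y (p q : hpath x y) : hrel p q -> hrel q p
| hrel_trans x y (p q r : hpath x y) : hrel p q -> hrel q r -> hrel p r
| hrel_cons x y z (e : edge x y) (p q : hpath y z) :
    hrel p q -> hrel (pcons e p) (pcons e q)
| hrel_degen x z (e : edge x x) (p : hpath x z) :
    sval e = degen 1 x -> hrel (pcons e p) p
| hrel_triangle w x y z (t : X 2) (e : edge w x) (f : edge x y) (g : edge w y)
    (p : hpath y z) :
    act (coface ord_max) t = sval e -> act (coface ord0) t = sval f ->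
    act (coface (lift ord0 ord0)) t = sval g ->
    hrel (pcons g p) (pcons e (pcons f p)).

Definition hrelb (X : sset) (x y : X 0) (p q : {classic hpath x y}) : bool :=
  `[< hrel p q >].

Lemma hrelb_refl X x y : reflexive (@hrelb X x y).
Proof. by move=> p; apply/asboolP; exact: hrel_refl. Qed.

Lemma hrelb_sym X x y : symmetric (@hrelb X x y).
Proof. by move=> p q; apply/asbool_equiv_eq; split; exact: hrel_sym. Qed.

Lemma hrelb_trans X x y : transitive (@hrelb X x y).
Proof.
by move=> q p r /asboolP pq /asboolP qr; apply/asboolP; exact: hrel_trans pq qr.
Qed.

Definition hequiv (X : sset) (x y : X 0) :=
  EquivRel (@hrelb X x y) (@hrelb_refl X x y) (@hrelb_sym X x y)
           (@hrelb_trans X x y).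

(* The hom-sets of the homotopy category, the value at [X] of the left adjoint
   to the nerve functor. *)
Definition hohom (X : sset) (x y : X 0) : Type := {eq_quot (hequiv x y)}.

Definition hocls (X : sset) (x y : X 0) (p : hpath x y) : hohom x y :=
  \pi_({eq_quot (hequiv x y)}) p.

Definition horep (X : sset) (x y : X 0) (a : hohom x y) : hpath x y :=
  repr (a : {eq_quot (hequiv x y)}).

Definition hoedge (X : sset) (x y : X 0) (e : edge x y) : hohom x y :=
  hocls (pcons e (pnil y)).

(* Composition in diagrammatic order: [a] followed by [b]. *)
Definition hocomp (X : sset) (x y z : X 0) (a : hohom x y) (b : hohom y z) :
  hohom x z := hocls (pcat (horep a) (horep b)).

Definition hocast (X : sset) (x x' y y' : X 0) (ex : x = x') (ey : y = y')
    (a : hohom x y) : hohom x' y' :=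
  ecast y (hohom x' y) ey (ecast x (hohom x y) ex a).

Lemma edge_map_subproof (X Y : sset) (F : smap X Y) (x y : X 0) (e : edge x y) :
  src (F 1 (sval e)) = F 0 x /\ tgt (F 1 (sval e)) = F 0 y.
Proof. by case: e => e [/= ex ey]; rewrite /src /tgt -!smap_act -ex -ey. Qed.

Definition edge_map (X Y : sset) (F : smap X Y) (x y : X 0) (e : edge x y) :
  edge (F 0 x) (F 0 y) := exist _ (F 1 (sval e)) (edge_map_subproof F e).

Fixpoint path_map (X Y : sset) (F : smap X Y) (x y : X 0) (p : hpath x y) :
    hpath (F 0 x) (F 0 y) :=
  match p in hpath x y return hpath (F 0 x) (F 0 y) with
  | pnil x => pnil (F 0 x)
  | pcons _ _ _ e p' => pcons (edge_map F e) (path_map F p')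
  end.

Definition homap (X Y : sset) (F : smap X Y) (x y : X 0) (a : hohom x y) :
  hohom (F 0 x) (F 0 y) := hocls (path_map F (horep a)).

(* Composition is a simplicial map [Map B C * Map A B -> Map A C], given
   levelwise. *)
Record scat := SCat {
  ob :> Type;
  Map : ob -> ob -> sset;
  idm : forall A, Map A A 0;
  ccomp : forall A B C n, Map B C n -> Map A B n -> Map A C n;
  comp_act : forall A B C m n (a : op m n) (g : Map B C n) (f : Map A B n),
    ccomp (act a g) (act a f) = act a (ccomp g f);
  comp1f : forall A B n (f : Map A B n), ccomp (degen n (idm B)) f = f;
  compf1 : forall A B n (f : Map A B n), ccomp f (degen n (idm A)) = f;
  compA : forall A B C D n (h : Map C D n) (g : Map B C n) (f : Map A B n),
    ccomp h (ccomp g f) = ccomp (ccomp h g) f }.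

Arguments Map {s}.
Arguments idm {s}.
Arguments ccomp {s A B C n}.

Notation "A ~> B" := (Map A B 0) (at level 90, B at level 69) : type_scope.
Infix "\oo" := ccomp (at level 50, left associativity).

Definition postc (K : scat) (A B C : K) n (g : B ~> C) (x : Map A B n) :
  Map A C n := degen n g \oo x.

Definition prec (K : scat) (A B C : K) n (x : Map B C n) (f : A ~> B) :
  Map A C n := x \oo degen n f.

Lemma degen_act (X : sset) m n (a : op m n) (x : X 0) : act a (degen n x) = degen m x.
Proof.
rewrite /degen -act_comp; congr act; apply: op_eq => i.
by rewrite op_compE !op_constE.
Qed.

Lemma degen0 (X : sset) (x : X 0) : degen 0 x = x.
Proof.
rewrite /degen -[RHS]act_id; congr act; apply: op_eq => i.
by rewrite op_constE op_idE ord1.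
Qed.

Lemma postc_act (K : scat) (A B C : K) (g : B ~> C) m n (a : op m n) (x : Map A B n) :
  postc g (act a x) = act a (postc g x).
Proof. by rewrite /postc -comp_act degen_act. Qed.

Lemma prec_act (K : scat) (A B C : K) (f : A ~> B) m n (a : op m n) (x : Map B C n) :
  prec (act a x) f = act a (prec x f).
Proof. by rewrite /prec -comp_act degen_act. Qed.

(* Map(A, g) and Map(f, C) *)
Definition map_post (K : scat) (A B C : K) (g : B ~> C) : smap (Map A B) (Map A C) :=
  @SMap _ _ (fun n x => postc g x) (postc_act g).

Definition map_pre (K : scat) (A B C : K) (f : A ~> B) : smap (Map B C) (Map A C) :=
  @SMap _ _ (fun n x => prec x f) (prec_act f).

Definition isomorphism (K : scat) (A B : K) (f : A ~> B) : Prop :=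
  exists g : B ~> A, g \oo f = idm A /\ f \oo g = idm B.

Definition equivalence (K : scat) (A B : K) (f : A ~> B) : Prop :=
  forall X : K, qcat_equivalence (map_post X f).

(* Simplicially enriched limits: the universal properties hold in every degree
   of the mapping spaces. *)
Definition is_terminal (K : scat) (T : K) : Prop :=
  forall (X : K) n, exists! x : Map X T n, True.

Definition is_product (K : scat) (A B P : K) (p : P ~> A) (q : P ~> B) : Prop :=
  forall (X : K) n (a : Map X A n) (b : Map X B n),
    exists! x : Map X P n, postc p x = a /\ postc q x = b.

Definition is_pullback (K : scat) (E A B P : K)
    (p : E ~> B) (f : A ~> B) (p1 : P ~> E) (p2 : P ~> A) : Prop :=
  p \oo p1 = f \oo p2 /\
  forall (X : K) n (a : Map X E n) (b : Map X A n), postc p a = postc f b ->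
    exists! x : Map X P n, postc p1 x = a /\ postc p2 x = b.

(* [C], with the universal cone [e], is a cotensor of [A] by [U]: the induced
   map from [Map X C] to the internal hom [Map X A ^ U], whose [n]-simplices are
   the maps [Delta n * U -> Map X A], is an isomorphism. *)
Definition is_cotensor (K : scat) (U : sset) (A C : K) (e : smap U (Map C A)) : Prop :=
  forall (X : K) n (g : smap (sprod (Delta n) U) (Map X A)),
    exists! x : Map X C n, forall m (a : op m n) (u : U m),
      g m (a, u) = e m u \oo act a x.

Record cosmos := Cosmos {
  cosmos_cat :> scat;
  isofib : forall A B : cosmos_cat, (A ~> B) -> Prop;
  one : cosmos_cat;
  map_qcat : forall A B : cosmos_cat, quasicategory (Map A B);
  oneP : is_terminal one;
  has_cotensors : forall (U : sset) (A : cosmos_cat), finitely_presented U ->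
    exists (C : cosmos_cat) (e : smap U (Map C A)), is_cotensor e;
  has_pullbacks : forall (E A B : cosmos_cat) (p : E ~> B) (f : A ~> B), isofib p ->
    exists (P : cosmos_cat) (p1 : P ~> E) (p2 : P ~> A), is_pullback p f p1 p2;
  isofib_comp : forall (A B C : cosmos_cat) (g : B ~> C) (f : A ~> B),
    isofib g -> isofib f -> isofib (g \oo f);
  isofib_iso : forall (A B : cosmos_cat) (f : A ~> B), isomorphism f -> isofib f;
  isofib_one : forall (A : cosmos_cat) (f : A ~> one), isofib f;
  isofib_pullback : forall (E A B P : cosmos_cat) (p : E ~> B) (f : A ~> B)
      (p1 : P ~> E) (p2 : P ~> A),
    is_pullback p f p1 p2 -> isofib p -> isofib p2;
  (* [Up], [Vp], [iE], [iB] are the maps induced between cotensors by [p] and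
     [i]; [P] is the pullback of [Up] along [iB]. *)
  isofib_leibniz : forall (U V : sset) (i : smap U V) (E B : cosmos_cat) (p : E ~> B)
      (UE UB VE VB P : cosmos_cat) (eUE : smap U (Map UE E)) (eUB : smap U (Map UB B))
      (eVE : smap V (Map VE E)) (eVB : smap V (Map VB B))
      (Up : UE ~> UB) (Vp : VE ~> VB) (iE : VE ~> UE) (iB : VB ~> UB)
      (p1 : P ~> UE) (p2 : P ~> VB) (l : VE ~> P),
    finitely_presented U -> finitely_presented V -> mono i -> isofib p ->
    is_cotensor eUE -> is_cotensor eUB -> is_cotensor eVE -> is_cotensor eVB ->
    (forall n (u : U n), prec (eUB n u) Up = postc p (eUE n u)) ->
    (forall n (v : V n), prec (eVB n v) Vp = postc p (eVE n v)) ->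
    (forall n (u : U n), prec (eUE n u) iE = eVE n (i n u)) ->
    (forall n (u : U n), prec (eUB n u) iB = eVB n (i n u)) ->
    is_pullback Up iB p1 p2 -> p1 \oo l = iE -> p2 \oo l = Vp ->
    isofib l;
  isofib_map : forall (X A B : cosmos_cat) (p : A ~> B), isofib p ->
    qcat_isofibration (map_post X p);
  cofibrant : forall (A E B : cosmos_cat) (p : E ~> B) (b : A ~> B),
    isofib p -> equivalence p -> exists e : A ~> E, p \oo e = b }.

Arguments one {c}.

Definition bang (K : cosmos) (A : K) : A ~> one := projT1 (cid (@oneP K A 0)).

(* The binary product bifunctor, as part of a simplicially enriched two-variable
   adjunction: [expo C B] is the object [C^B], and [exp_map c b] the value of the
   enriched bifunctor (covariant in [C], contravariant in [B]) at [c] and [b].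
   In the naturality conditions [w] is the value [a * b] of the product
   bifunctor. *)
Record cartesian_closed (K : cosmos) := CartesianClosed {
  bprod : K -> K -> K;
  pr1 : forall A B : K, bprod A B ~> A;
  pr2 : forall A B : K, bprod A B ~> B;
  prodP : forall A B : K, is_product (pr1 A B) (pr2 A B);
  expo : K -> K -> K;
  exp_map : forall (C C' B B' : K) n,
    Map C C' n -> Map B' B n -> Map (expo C B) (expo C' B') n;
  exp_map_act : forall (C C' B B' : K) m n (a : op m n)
      (c : Map C C' n) (b : Map B' B n),
    exp_map (act a c) (act a b) = act a (exp_map c b);
  exp_map_id : forall C B : K, exp_map (idm C) (idm B) = idm (expo C B);
  exp_map_comp : forall (C C' C'' B B' B'' : K) n
      (c' : Map C' C'' n) (c : Map C C' n) (b : Map B' B n) (b' : Map B'' B' n),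
    exp_map (c' \oo c) (b \oo b') = exp_map c' b' \oo exp_map c b;
  curry : forall A B C : K, siso (Map (bprod A B) C) (Map A (expo C B));
  curry_nat : forall (A A' B B' C C' : K) n
      (a : Map A' A n) (b : Map B' B n) (c : Map C C' n)
      (w : Map (bprod A' B') (bprod A B) n) (y : Map (bprod A B) C n),
    postc (pr1 A B) w = prec a (pr1 A' B') ->
    postc (pr2 A B) w = prec b (pr2 A' B') ->
    curry A' B' C' n (c \oo (y \oo w)) = exp_map c b \oo (curry A B C n y \oo a);
  curry' : forall A B C : K, siso (Map (bprod A B) C) (Map B (expo C A));
  curry'_nat : forall (A A' B B' C C' : K) n
      (a : Map A' A n) (b : Map B' B n) (c : Map C C' n)
      (w : Map (bprod A' B') (bprod A B) n) (y : Map (bprod A B) C n),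
    postc (pr1 A B) w = prec a (pr1 A' B') ->
    postc (pr2 A B) w = prec b (pr2 A' B') ->
    curry' A' B' C' n (c \oo (y \oo w)) = exp_map c a \oo (curry' A B C n y \oo b) }.

Arguments bprod {K}.
Arguments pr1 {K}.
Arguments pr2 {K}.
Arguments expo {K}.
Arguments exp_map {K} c {C C' B B' n} : rename.
Arguments curry {K}.

Definition cell (K : scat) (A B : K) (f g : A ~> B) : Type := hohom f g.

(* Vertical composition: [vcomp b a] is [b] after [a]. *)
Definition vcomp (K : scat) (A B : K) (f g h : A ~> B) (b : cell g h) (a : cell f g) :
  cell f h := hocomp a b.

Lemma postc0 (K : scat) (A B C : K) (r : B ~> C) (f : A ~> B) : postc r f = r \oo f.
Proof. by rewrite /postc degen0. Qed.

Lemma prec0 (K : scat) (A B C : K) (f : B ~> C) (k : A ~> B) : prec f k = f \oo k.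
Proof. by rewrite /prec degen0. Qed.

Definition lwhisk (K : scat) (A B C : K) (r : B ~> C) (f g : A ~> B) (a : cell f g) :
  cell (r \oo f) (r \oo g) :=
  hocast (postc0 r f) (postc0 r g) (homap (map_post A r) a).

Definition rwhisk (K : scat) (A B C : K) (f g : B ~> C) (a : cell f g) (k : A ~> B) :
  cell (f \oo k) (g \oo k) :=
  hocast (prec0 f k) (prec0 g k) (homap (map_pre C k) a).

(* Composites of 1-cells are associative only up to a propositional equality;
   the casts below are along instances of [compA]. *)
Definition is_absolute_right_lifting (K : scat) (P Q L : K)
    (u : P ~> Q) (f : L ~> Q) (r : L ~> P) (nu : cell (u \oo r) f) : Prop :=
  forall (X : K) (p : X ~> L) (q : X ~> P) (chi : cell (u \oo q) (f \oo p)),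
    exists! zeta : cell q (r \oo p),
      chi = vcomp (rwhisk nu p) (hocast erefl (compA u r p) (lwhisk u zeta)).

Definition is_right_extension (K : scat) (A B C : K)
    (k : A ~> B) (f : A ~> C) (r : B ~> C) (mu : cell (r \oo k) f) : Prop :=
  forall e : B ~> C,
    bijective (fun beta : cell e r => vcomp mu (rwhisk beta k)).

(* The pasting of [mu] with a square [lam], a 2-cell [r b h => f g]. *)
Definition paste (K : scat) (A B C D E : K)
    (k : A ~> B) (f : A ~> C) (r : B ~> C) (mu : cell (r \oo k) f)
    (h : D ~> E) (g : D ~> A) (b : E ~> B) (lam : cell (b \oo h) (k \oo g)) :
  cell (r \oo b \oo h) (f \oo g) :=
  vcomp (rwhisk mu g) (hocast (compA r b h) (compA r k g) (lwhisk r lam)).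

Definition stable_under_pasting (K : scat) (A B C D E : K)
    (k : A ~> B) (f : A ~> C) (r : B ~> C) (mu : cell (r \oo k) f)
    (h : D ~> E) (g : D ~> A) (b : E ~> B) (lam : cell (b \oo h) (k \oo g)) : Prop :=
  is_right_extension (paste mu lam).

(* [D], with its projections and the 2-cell [phi], is a comma object of [f] and
   [g]: [D] is the pullback of [ev = (ev_1, ev_0)], where [Aarr] is the cotensor
   of [A] by [Delta 1], along [gf = g * f]; [w] is the projection to [Aarr], and
   [phi] is the class of the 1-simplex of [Map D A] corresponding to [w]. *)
Definition is_comma (K : scat) (A B C D : K) (f : B ~> A) (g : C ~> A)
    (p1 : D ~> C) (p0 : D ~> B) (phi : cell (f \oo p0) (g \oo p1)) : Prop :=
  exists (Aarr AA CB : K) (e : smap (Delta 1) (Map Aarr A))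
      (a1 a0 : AA ~> A) (c1 : CB ~> C) (c0 : CB ~> B)
      (ev : Aarr ~> AA) (gf : CB ~> AA) (w : D ~> Aarr) (d : D ~> CB)
      (s : edge (f \oo p0) (g \oo p1)),
    [/\ is_cotensor e, is_product a1 a0 & is_product c1 c0] /\
    [/\ a1 \oo ev = e 0 (op_const 0 ord_max) & a0 \oo ev = e 0 (op_const 0 ord0)] /\
    [/\ a1 \oo gf = g \oo c1 & a0 \oo gf = f \oo c0] /\
    is_pullback ev gf w d /\
    [/\ c1 \oo d = p1 & c0 \oo d = p0] /\
    sval s = prec (e 1 (op_id 1)) w /\ phi = hoedge s.

Definition is_pointwise_right_kan (K : scat) (A B C : K)
    (k : A ~> B) (f : A ~> C) (r : B ~> C) (mu : cell (r \oo k) f) : Prop :=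
  is_right_extension mu /\
  forall (D E : K) (b : E ~> B) (g : D ~> A) (h : D ~> E)
      (lam : cell (b \oo h) (k \oo g)),
    is_comma lam -> stable_under_pasting mu lam.

(* The transpose [1 -> E^A] of a functor [A -> E], and its action on mapping
   spaces. *)
Definition transp (K : cosmos) (cc : cartesian_closed K) (A E : K) :
  smap (Map A E) (Map one (expo cc E A)) :=
  s_comp (curry cc one A E) (map_pre E (pr2 cc one A)).

(* The isomorphism [(!, id) : A -> 1 * A]. *)
Definition one_prod (K : cosmos) (cc : cartesian_closed K) (A : K) :
  A ~> bprod cc one A := projT1 (cid (prodP cc (bang A) (idm A))).

Definition untransp (K : cosmos) (cc : cartesian_closed K) (A E : K) :
  smap (Map one (expo cc E A)) (Map A E) :=
  s_comp (map_pre E (one_prod cc A)) (sbwd (curry cc one A E)).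

(* [E^k : E^B -> E^A] *)
Definition exp_pre (K : cosmos) (cc : cartesian_closed K) (A B E : K) (k : A ~> B) :
  expo cc E B ~> expo cc E A := exp_map cc (idm E) k.

(* [E^! : E -> E^A], where [E] is identified with [E^1]. *)
Definition const_diagram (K : cosmos) (cc : cartesian_closed K) (A E : K) :
  E ~> expo cc E A := exp_pre cc E (bang A) \oo curry cc E one E 0 (pr1 cc E one).

Definition is_limit (K : cosmos) (cc : cartesian_closed K) (A E : K)
    (f : A ~> E) (l : one ~> E)
    (nu : cell (const_diagram cc A E \oo l) (transp cc A E 0 f)) : Prop :=
  is_absolute_right_lifting nu.

Lemma one_unique (K : cosmos) (X : K) n (x y : Map X one n) : x = y.
Proof. by have [z [_ zP]] := @oneP K X n; rewrite -(zP x) // -(zP y). Qed.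

Lemma one_prodP (K : cosmos) (cc : cartesian_closed K) (A : K) :
  pr1 cc one A \oo one_prod cc A = bang A /\ pr2 cc one A \oo one_prod cc A = idm A.
Proof.
by rewrite -!postc0 /one_prod; case: cid => x /= [].
Qed.

Lemma compm1 (K : scat) (A B : K) (f : A ~> B) : f \oo idm A = f.
Proof. by rewrite -[idm A]degen0 compf1. Qed.

Lemma comp1m (K : scat) (A B : K) (f : A ~> B) : idm B \oo f = f.
Proof. by rewrite -[idm B]degen0 comp1f. Qed.

Lemma transpK (K : cosmos) (cc : cartesian_closed K) (A E : K) (f : A ~> E) :
  untransp cc A E 0 (transp cc A E 0 f) = f.
Proof.
rewrite /= sfwdK !prec0 -compA; have [_ ->] := one_prodP cc A; exact: compm1.
Qed.

Lemma transp_const (K : cosmos) (cc : cartesian_closed K) (A E : K) (l : one ~> E) :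
  transp cc A E 0 (l \oo bang A) = const_diagram cc A E \oo l.
Proof.
rewrite /= prec0 /const_diagram /exp_pre -[RHS]compA.
have [w [[w1 w2] _]] := prodP cc (l \oo pr1 cc one A) (bang A \oo pr2 cc one A).
rewrite -(@curry_nat K cc _ _ _ _ _ _ _ l (bang A) (idm E) w) ?prec0 //.
rewrite comp1m -[_ \oo w]postc0 w1 -[LHS]/(curry cc one A E 0 _); congr (curry cc one A E 0 _).
by rewrite -compA; congr (_ \oo _); exact: one_unique.
Qed.

Lemma untransp_const (K : cosmos) (cc : cartesian_closed K) (A E : K) (l : one ~> E) :
  untransp cc A E 0 (const_diagram cc A E \oo l) = l \oo bang A.
Proof. by rewrite -transp_const transpK. Qed.

(* Transposition of 2-cells along the isomorphism of mapping spaces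
   [Map A E ~ Map 1 E^A]. *)
Definition transpose (K : cosmos) (cc : cartesian_closed K) (A E : K)
    (f : A ~> E) (l : one ~> E)
    (nu : cell (const_diagram cc A E \oo l) (transp cc A E 0 f)) :
  cell (l \oo bang A) f :=
  hocast (untransp_const cc A l) (transpK cc f) (homap (untransp cc A E) nu).

Definition untranspose (K : cosmos) (cc : cartesian_closed K) (A E : K)
    (f : A ~> E) (l : one ~> E) (mu : cell (l \oo bang A) f) :
  cell (const_diagram cc A E \oo l) (transp cc A E 0 f) :=
  hocast (transp_const cc A l) erefl (homap (transp cc A E) mu).

(* Main.v *)
From mathcomp Require Import all_boot boolp.
Require Import Defs.

Set Implicit Arguments.
Unset Strict Implicit.
Unset Printing Implicit Defensive.

Local Open Scope quotient_scope.

(** Everything comes down to one observation about a single shape [X].  Let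
    [h : D -> X] and [g : D -> A] exhibit [D] as a product of [X] and [A], and
    let [p : X -> 1].  Transposing and then precomposing with the comparison
    [D ~ X * A] is an isomorphism of simplicial sets from [Map X (E^A)] to
    [Map D E].  It carries postcomposition with the constant diagram functor
    [E -> E^A] to precomposition with [h], and precomposition with [p] to
    transposition followed by precomposition with [g] ([transposition]).
    Being a simplicial map, it acts on 2-cells by a bijection compatible with
    vertical composition, so it turns the equation

      [chi = nu p . (const_diagram zeta)]   in [hom (X, E^A)]

    that [zeta : q => l p] has to solve in the lifting property of [nu] into

      [chi' = (transpose nu) g . zeta h]    in [hom (D, E)],

    the equation that [zeta] has to solve in the extension property of the
    whiskered transpose along [h].  Hence the lifting property of [nu] at [X]
    and [p] is equivalent to that extension property ([lifts_atP]).

    The theorem follows because the comma squares over [! : A -> 1] are exactly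
    these product squares.  As [1] is terminal, so are its cotensor by [Delta 1]
    and its square, and the pullback defining a comma object of [X -> 1 <- A]
    imposes no condition ([comma_product]); conversely every product of [X] and
    [A] is such a comma object ([product_comma]).  The 2-cell of a comma square
    lies over the terminal object, so it is an identity and pasting with it is
    whiskering by [g] ([arr_paste]).  That the transpose is itself a right
    extension is the case of the product [1 <- A -> A].

    Associativity and unit laws of 1-cells hold only propositionally, so 2-cells
    that should be equal often live between endpoints that are not convertible.
    They are compared in the type [arrow X] of all arrows of a homotopy
    category, where casts along equalities of endpoints disappear. *)

(** * Functoriality of the homotopy category *)

Lemma smap_ext (X Y : sset) (F G : smap X Y) :
  (forall n x, F n x = G n x) -> F = G.
Proof.
case: F G => [F FP] [G GP] /= FG.
have eFG : F = G.
  by apply: functional_extensionality_dep => n; apply/funext; exact: FG.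
by case: _ / eFG GP {FG} => GP; congr SMap; exact: Prop_irrelevance.
Qed.

Lemma edge_eq (X : sset) (x y : X 0) (e e' : edge x y) :
  sval e = sval e' -> e = e'.
Proof.
case: e e' => [e p] [e' p'] /= ee; case: _ / ee p' => p'.
by congr exist; exact: Prop_irrelevance.
Qed.

Lemma hocls_eq (X : sset) (x y : X 0) (p q : hpath x y) :
  hocls p = hocls q <-> hrel p q.
Proof.
split=> [/eqmodP/asboolP//|pq].
by apply/eqmodP/asboolP.
Qed.

Lemma horepK (X : sset) (x y : X 0) (a : hohom x y) : hocls (horep a) = a.
Proof. exact: reprK. Qed.

Lemma horepP (X : sset) (x y : X 0) (p : hpath x y) : hrel (horep (hocls p)) p.
Proof. by apply/hocls_eq; exact: horepK. Qed.

Lemma hocls_surj (X : sset) (x y : X 0) (a : hohom x y) : exists p, a = hocls p.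
Proof. by exists (horep a); rewrite horepK. Qed.

(** The generating relations of [hrel] come with an arbitrary tail, to which [q] can
    be appended. *)
Lemma hrel_catl (X : sset) (x y z : X 0) (p p' : hpath x y) (q : hpath y z) :
  hrel p p' -> hrel (pcat p q) (pcat p' q).
Proof.
move=> pp'; elim: pp' z q => /=.
- by move=> *; exact: hrel_refl.
- by move=> u v r s _ IH t q; apply: hrel_sym; exact: IH.
- by move=> u v r s t _ IH _ IH' w q; exact: hrel_trans (IH _ q) (IH' _ q).
- by move=> u v w e r s _ IH t q; apply: hrel_cons; exact: IH.
- by move=> u v e r ex t q; exact: hrel_degen.
- by move=> *; eapply hrel_triangle; eassumption.
Qed.

Lemma hrel_catr (X : sset) (x y z : X 0) (p : hpath x y) (q q' : hpath y z) :
  hrel q q' -> hrel (pcat p q) (pcat p q').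
Proof.
by elim: p q q' => //= u v w e p IH q q' qq'; apply: hrel_cons; exact: IH.
Qed.

Lemma hrel_pcat (X : sset) (x y z : X 0) (p p' : hpath x y) (q q' : hpath y z) :
  hrel p p' -> hrel q q' -> hrel (pcat p q) (pcat p' q').
Proof. by move=> pp' qq'; exact: hrel_trans (hrel_catl q pp') (hrel_catr p' qq'). Qed.

Lemma hocomp_cls (X : sset) (x y z : X 0) (p : hpath x y) (q : hpath y z) :
  hocomp (hocls p) (hocls q) = hocls (pcat p q).
Proof. by apply/hocls_eq/hrel_pcat; exact: horepP. Qed.

Lemma hrel_path_map (X Y : sset) (F : smap X Y) (x y : X 0) (p q : hpath x y) :
  hrel p q -> hrel (path_map F p) (path_map F q).
Proof.
elim=> /=.
- by move=> *; exact: hrel_refl.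
- by move=> *; exact: hrel_sym.
- by move=> u v r s t _ rs _; exact: hrel_trans rs.
- by move=> *; exact: hrel_cons.
- by move=> u v e r ex; apply: hrel_degen; rewrite /= ex smap_act.
- move=> u v w z t e f g r te tf tg.
  by apply: (@hrel_triangle _ _ _ _ _ (F 2 t)); rewrite -smap_act ?te ?tf ?tg.
Qed.

Lemma homap_cls (X Y : sset) (F : smap X Y) (x y : X 0) (p : hpath x y) :
  homap F (hocls p) = hocls (path_map F p).
Proof. by apply/hocls_eq/hrel_path_map; exact: horepP. Qed.

Lemma path_map_cat (X Y : sset) (F : smap X Y) (x y z : X 0)
    (p : hpath x y) (q : hpath y z) :
  path_map F (pcat p q) = pcat (path_map F p) (path_map F q).
Proof. by elim: p q => //= *; congr pcons. Qed.

Lemma path_map_comp (X Y Z : sset) (G : smap Y Z) (F : smap X Y) (x y : X 0)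
    (p : hpath x y) :
  path_map (s_comp G F) p = path_map G (path_map F p).
Proof. by elim: p => //= *; congr pcons => //; exact: edge_eq. Qed.

Lemma path_map_id (X : sset) (x y : X 0) (p : hpath x y) :
  path_map (s_id X) p = p.
Proof. by elim: p => //= *; congr pcons => //; exact: edge_eq. Qed.

Lemma homap_comp (X Y : sset) (F : smap X Y) (x y z : X 0)
    (a : hohom x y) (b : hohom y z) :
  homap F (hocomp a b) = hocomp (homap F a) (homap F b).
Proof.
have [p ->] := hocls_surj a; have [q ->] := hocls_surj b.
by rewrite hocomp_cls !homap_cls hocomp_cls path_map_cat.
Qed.

(** * Arrows with variable endpoints *)

(** Packing the endpoints with the arrow makes a cast along equal endpoints an
    equality ([arr_cast]), and by proof irrelevance nothing is lost
    ([arr_inj]). *)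
Definition arrow (X : sset) := {xy : X 0 * X 0 & hohom xy.1 xy.2}.

Definition arr (X : sset) (x y : X 0) (a : hohom x y) : arrow X :=
  existT (fun xy : X 0 * X 0 => hohom xy.1 xy.2) (x, y) a.

Definition arrow_map (X Y : sset) (F : smap X Y) (t : arrow X) : arrow Y :=
  arr (homap F (projT2 t)).

Lemma arr_ends (X : sset) (x y x' y' : X 0) (a : hohom x y) (b : hohom x' y') :
  arr a = arr b -> x = x' /\ y = y'.
Proof. by move=> /(congr1 (@projT1 _ _)) /= [-> ->]. Qed.

Lemma arr_cast (X : sset) (x x' y y' : X 0) (ex : x = x') (ey : y = y')
    (a : hohom x y) : arr (hocast ex ey a) = arr a.
Proof. by case: _ / ex; case: _ / ey. Qed.

Lemma arr_inj (X : sset) (x y : X 0) : injective (@arr X x y).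
Proof.
move=> a b ab.
(* Generalizing the right-hand side lets the equality be eliminated; what remains
   is a loop on the endpoints, trivial by proof irrelevance. *)
have: forall t (e : arr a = t) (e1 : (x, y) = projT1 t),
    projT2 t = ecast xy (hohom xy.1 xy.2) e1 a.
  move=> t; case: _ / => /= e1.
  by rewrite (Prop_irrelevance e1 erefl).
by move/(_ _ ab erefl).
Qed.

Lemma arr_comp (X : sset) (x y z x' y' z' : X 0) (a : hohom x y) (b : hohom y z)
    (a' : hohom x' y') (b' : hohom y' z') :
  arr a = arr a' -> arr b = arr b' -> arr (hocomp a b) = arr (hocomp a' b').
Proof.
move=> aa' bb'; have [ex ey] := arr_ends aa'; have [_ ez] := arr_ends bb'.
case: _ / ex a' aa' => a' aa'; case: _ / ez b' bb' => b' bb'.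
case: _ / ey a' b' aa' bb' => a' b' /arr_inj-> /arr_inj->; by [].
Qed.

Lemma arr_map (X Y : sset) (F : smap X Y) (x y : X 0) (a : hohom x y) :
  arr (homap F a) = arrow_map F (arr a).
Proof. by []. Qed.

Lemma arrow_map_comp (X Y Z : sset) (G : smap Y Z) (F : smap X Y) (t : arrow X) :
  arrow_map G (arrow_map F t) = arrow_map (s_comp G F) t.
Proof.
case: t => [[x y] /= a]; rewrite /arrow_map /=; have [p ->] := hocls_surj a.
by rewrite !homap_cls path_map_comp.
Qed.

Lemma arrow_map_id (X : sset) (t : arrow X) : arrow_map (s_id X) t = t.
Proof.
case: t => [[x y] /= a]; rewrite /arrow_map /=; have [p ->] := hocls_surj a.
by rewrite homap_cls path_map_id.
Qed.

Lemma arr_lwhisk (K : scat) (A B C : K) (r : B ~> C) (f g : A ~> B) (a : cell f g) :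
  arr (lwhisk r a) = arrow_map (map_post A r) (arr a).
Proof. exact: arr_cast. Qed.

Lemma arr_rwhisk (K : scat) (A B C : K) (f g : B ~> C) (a : cell f g) (k : A ~> B) :
  arr (rwhisk a k) = arrow_map (map_pre C k) (arr a).
Proof. exact: arr_cast. Qed.

Lemma hocomp1l (X : sset) (x y : X 0) (a : hohom x y) :
  hocomp (hocls (pnil x)) a = a.
Proof. by have [p ->] := hocls_surj a; rewrite hocomp_cls. Qed.

(** All vertices agree and every edge is degenerate, so each step of a path can be
    erased.  This is applied to the mapping spaces into the terminal object. *)
Lemma arr_subsingleton (X : sset) (x y : X 0) (a : hohom x y) :
  (forall n (u v : X n), u = v) -> arr a = arr (hocls (pnil x)).
Proof.
move=> X1; have [p ->] := hocls_surj a; elim: p => // u v w e p IH.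
have euv : u = v by exact: X1.
case: _ / euv e p IH => e p <-.
by congr arr; apply/hocls_eq/hrel_degen; exact: X1.
Qed.

(** * Bijections *)

Lemma bijectiveP (S T : Type) (F : S -> T) :
  bijective F <-> forall y, exists! x, y = F x.
Proof.
split=> [[G FK GK] y|F1].
  by exists (G y); split=> [|x ->]; rewrite ?GK ?FK.
have /choice[G GP] y := F1 y.
exists G => [x|y]; last by rewrite -(GP y).1.
by have [_] := GP (F x); apply.
Qed.

Lemma bijective_compl (S T U : Type) (F : T -> U) (G : S -> T) :
  bijective F -> bijective (F \o G) <-> bijective G.
Proof.
move=> bF; split=> [[H HK KH]|]; last exact: bij_comp.
have [F' FK F'K] := bF.
exists (H \o F) => x /=; first exact: HK.
by apply: (can_inj FK); rewrite [LHS]KH.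
Qed.

(** * Composition and products in a simplicial category *)

Lemma postc_comp (K : scat) (A B C D : K) (g : C ~> D) (f : B ~> C) n (x : Map A B n) :
  postc (g \oo f) x = postc g (postc f x).
Proof. by rewrite /postc /degen -comp_act compA. Qed.

Lemma prec_comp (K : scat) (A B C D : K) n (x : Map C D n) (f : B ~> C) (g : A ~> B) :
  prec x (f \oo g) = prec (prec x f) g.
Proof. by rewrite /prec /degen -comp_act compA. Qed.

Lemma prec_id (K : scat) (A B : K) n (x : Map A B n) : prec x (idm A) = x.
Proof. exact: compf1. Qed.

Lemma product_eq (K : scat) (A B P X : K) (p : P ~> A) (q : P ~> B) n (x y : Map X P n) :
  is_product p q -> postc p x = postc p y -> postc q x = postc q y -> x = y.
Proof.
move=> /(_ X n (postc p x) (postc q x))[z [_ z1]] pxy qxy.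
by rewrite -(z1 x) // -(z1 y).
Qed.

(** * Transposition of 2-cells along a product *)

Lemma product_unique (K : cosmos) (cc : cartesian_closed K) (A X D : K)
    (h : D ~> X) (g : D ~> A) :
  is_product h g ->
  exists (w : D ~> bprod cc X A) (v : bprod cc X A ~> D),
  [/\ pr1 cc X A \oo w = h, pr2 cc X A \oo w = g,
      w \oo v = idm _ & v \oo w = idm _].
Proof.
move=> hgP; have [w [[w1 w2] _]] := prodP cc h g.
have [v [[v1 v2] _]] := hgP _ _ (pr1 cc X A) (pr2 cc X A).
rewrite !postc0 in w1 w2 v1 v2.
exists w, v; split=> //.
  by apply: (product_eq (@prodP K cc X A)); rewrite !postc0 compA ?w1 ?w2 ?v1 ?v2 compm1.
by apply: (product_eq hgP); rewrite !postc0 compA ?w1 ?w2 ?v1 ?v2 compm1.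
Qed.

(** By definition the constant diagram functor is [E^!] after the transpose of the
    projection [E * 1 -> E], so this is naturality of transposition along
    [q * ! : X * A -> E * 1]. *)
Lemma curry_const (K : cosmos) (cc : cartesian_closed K) (A E X : K) n
    (q : Map X E n) :
  curry cc X A E n (prec q (pr1 cc X A)) = postc (const_diagram cc A E) q.
Proof.
have [w [[w1 w2] _]] :=
  prodP cc (prec q (pr1 cc X A)) (degen n (bang A) \oo degen n (pr2 cc X A)).
rewrite /const_diagram postc_comp /exp_pre.
rewrite {1}/postc [degen n (exp_map _ _ _)]/degen -exp_map_act.
rewrite {1}/postc [degen n (curry _ _ _ _ _ _)]/degen -smap_act.
rewrite -(@curry_nat K cc E X one A E E n q _ _ w) //.
by rewrite comp1f [_ \oo w]w1.
Qed.

Lemma curry_reindex (K : cosmos) (cc : cartesian_closed K) (A E X : K) n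
    (p : X ~> one) (w : bprod cc X A ~> bprod cc one A)
    (t : Map (bprod cc one A) E n) :
  pr1 cc one A \oo w = p \oo pr1 cc X A -> pr2 cc one A \oo w = pr2 cc X A ->
  curry cc X A E n (prec t w) = prec (curry cc one A E n t) p.
Proof.
move=> w1 w2.
(* Padding with identities brings the right-hand side into the shape of the
   naturality condition. *)
have -> : prec (curry cc one A E n t) p
    = exp_map cc (degen n (idm E)) (degen n (idm A)) \oo
      (curry cc one A E n t \oo degen n p).
  by rewrite /degen exp_map_act exp_map_id comp1f.
rewrite -(@curry_nat K cc one X A A E E n _ _ _ (degen n w)) ?comp1f //.
  by rewrite /postc /prec /degen !comp_act w1.
by rewrite /postc /prec /degen !comp_act w2 comp1m.
Qed.

(** [F] transposes and restricts along [D ~ X * A]; the last two equations are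
    what makes it translate liftings into extensions. *)
Lemma transposition (K : cosmos) (cc : cartesian_closed K) (A E X D : K)
    (h : D ~> X) (g : D ~> A) :
  is_product h g ->
  exists (F : smap (Map X (expo cc E A)) (Map D E))
    (G : smap (Map D E) (Map X (expo cc E A))),
  [/\ s_comp F G = s_id _, s_comp G F = s_id _,
      s_comp F (map_post X (const_diagram cc A E)) = map_pre E h
    & forall p : X ~> one,
        s_comp F (map_pre _ p) = s_comp (map_pre E g) (untransp cc A E)].
Proof.
move=> hgP; have [w [v [w1 w2 wv vw]]] := product_unique cc hgP.
exists (s_comp (map_pre E w) (sbwd (curry cc X A E))).
exists (s_comp (curry cc X A E) (map_pre E v)).
split.
- by apply: smap_ext => n x; rewrite /= sfwdK -prec_comp vw prec_id.
- by apply: smap_ext => n x; rewrite /= -prec_comp wv prec_id sbwdK.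
- by apply: smap_ext => n x; rewrite /= -curry_const sfwdK -prec_comp w1.
move=> p; apply: smap_ext => n x /=.
have [u [[u1 u2] _]] := prodP cc (p \oo pr1 cc X A) (pr2 cc X A).
rewrite !postc0 in u1 u2.
rewrite -{1}[x](@sbwdK _ _ (curry cc one A E)) -(curry_reindex _ u1 u2) sfwdK.
rewrite -!prec_comp; congr prec.
have [_ o2] := one_prodP cc A.
apply: (product_eq (@prodP K cc one A)); first exact: one_unique.
by rewrite !postc0 !compA u2 w2 o2 comp1m.
Qed.

Lemma homap_bij (X Y : sset) (F : smap X Y) (G : smap Y X) :
  s_comp F G = s_id _ -> s_comp G F = s_id _ ->
  forall (x y : X 0) (x' y' : Y 0) (ex : F 0 x = x') (ey : F 0 y = y'),
  bijective (fun a : hohom x y => hocast ex ey (homap F a)).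
Proof.
move=> FG GF x y x' y' ex ey.
have GFx z : G 0 (F 0 z) = z by rewrite -[LHS]/(s_comp G F 0 z) GF.
have ex' : G 0 x' = x by rewrite -ex GFx.
have ey' : G 0 y' = y by rewrite -ey GFx.
exists (fun b => hocast ex' ey' (homap G b)) => a; apply: arr_inj.
  by rewrite arr_cast arr_map arr_cast arr_map arrow_map_comp GF arrow_map_id.
by rewrite arr_cast arr_map arr_cast arr_map arrow_map_comp FG arrow_map_id.
Qed.

(** * Liftings as extensions *)

Lemma right_extension_cast (K : scat) (A B C : K) (k : A ~> B) (f f' : A ~> C)
    (r r' : B ~> C) (mu : cell (r \oo k) f) (mu' : cell (r' \oo k) f') :
  r = r' -> arr mu = arr mu' -> is_right_extension mu -> is_right_extension mu'.
Proof.
move=> er emu; have [_ ef] := arr_ends emu.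
by case: _ / er mu' emu => mu' emu; case: _ / ef mu' emu => mu' /arr_inj->.
Qed.

(** The component at [p] of the universal property of an absolute right lifting. *)
Definition lifts_at (K : cosmos) (cc : cartesian_closed K) (A E : K) (f : A ~> E)
    (l : one ~> E) (nu : cell (const_diagram cc A E \oo l) (transp cc A E 0 f))
    (X : K) (p : X ~> one) : Prop :=
  forall (q : X ~> E)
      (chi : cell (const_diagram cc A E \oo q) (transp cc A E 0 f \oo p)),
    exists! zeta : cell q (l \oo p),
      chi = vcomp (rwhisk nu p)
              (hocast erefl (compA (const_diagram cc A E) l p)
                 (lwhisk (const_diagram cc A E) zeta)).

(** [m] stands for the transpose of [nu] whiskered by [g].  It is a separate
    argument because its source [l p h] is only propositionally equal to the
    source [l ! g] of that whiskering. *)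
Lemma lifts_atP (K : cosmos) (cc : cartesian_closed K) (A E : K) (f : A ~> E)
    (l : one ~> E) (nu : cell (const_diagram cc A E \oo l) (transp cc A E 0 f))
    (X D : K) (h : D ~> X) (g : D ~> A) (p : X ~> one)
    (m : cell ((l \oo p) \oo h) (f \oo g)) :
  is_product h g -> arr m = arr (rwhisk (transpose nu) g) ->
  lifts_at nu p <-> is_right_extension m.
Proof.
move=> hgP em; have [F [G [FG GF Fq Fp]]] := transposition cc E hgP.
have e1 q : F 0 (const_diagram cc A E \oo q) = q \oo h.
  by rewrite -postc0 -prec0 -[LHS]/(s_comp F (map_post X _) 0 q) Fq.
have e2 : F 0 (transp cc A E 0 f \oo p) = f \oo g.
  rewrite -prec0 -[LHS]/(s_comp F (map_pre _ p) 0 _) Fp.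
  by rewrite -[LHS]/(prec (untransp cc A E 0 (transp cc A E 0 f)) g) transpK prec0.
(* The extension map is the lifting map followed by the bijection that [F] induces
   on 2-cells. *)
have key q : (fun zeta : cell q (l \oo p) => vcomp m (rwhisk zeta h)) =
  (fun a => hocast (e1 q) e2 (homap F a)) \o
  (fun zeta => vcomp (rwhisk nu p)
              (hocast erefl (compA (const_diagram cc A E) l p)
                 (lwhisk (const_diagram cc A E) zeta))).
  apply/funext => zeta /=; apply: arr_inj.
  rewrite arr_cast /vcomp homap_comp; apply: arr_comp.
    by rewrite arr_rwhisk arr_map arr_cast arr_lwhisk arrow_map_comp Fq.
  rewrite em !arr_map !arr_rwhisk arr_cast arr_map arrow_map_comp.
  by rewrite [RHS]arrow_map_comp Fp.
split=> [lp q|rm q].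
  rewrite key; apply/bijective_compl; first exact: (homap_bij FG GF).
  by apply/bijectiveP; exact: lp.
apply/bijectiveP; have := rm q; rewrite key => /bijective_compl; apply.
exact: (homap_bij FG GF).
Qed.

(** * Comma squares over the terminal object *)

(** The 2-cell [lam] lies in a mapping space into [1], so it is an identity and
    drops out of the pasting. *)
Lemma arr_paste (K : cosmos) (A C D E : K) (k : A ~> one) (f : A ~> C)
    (r : one ~> C) (mu : cell (r \oo k) f) (h : D ~> E) (g : D ~> A) (b : E ~> one)
    (lam : cell (b \oo h) (k \oo g)) :
  arr (paste mu lam) = arr (rwhisk mu g).
Proof.
rewrite -[rwhisk mu g]hocomp1l; apply: arr_comp => //.
rewrite arr_cast arr_lwhisk (arr_subsingleton lam (@one_unique K D)).
rewrite -arr_map homap_cls /= postc0 compA; congr (arr (hocls (pnil _))).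
by rewrite -!compA; congr (r \oo _); exact: one_unique.
Qed.

(** The corner of the pullback and the cotensor of [1] by [Delta 1] are terminal,
    so a map into the comma object is just a pair of maps into [X] and [A]. *)
Lemma comma_product (K : cosmos) (A X D : K) (k : A ~> one) (b : X ~> one)
    (g : D ~> A) (h : D ~> X) (lam : cell (b \oo h) (k \oo g)) :
  is_comma lam -> is_product h g.
Proof.
case=> I [T [P [e [a1 [a0 [c1 [c0 [ev [gf [w [d [s]]]]]]]]]]]].
case=> -[eP aP cP] [_ [_ [[_ wdP] [[dg dh] _]]]].
have T1 Y n (u v : Map Y T n) : u = v.
  by apply: (product_eq aP); exact: one_unique.
have trivial_map Y n : smap (sprod (Delta n) (Delta 1)) (Map Y (@one K)).
  have c m : Map Y (@one K) m by have [z _] := cid (@oneP K Y m).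
  by apply: (@SMap _ _ (fun m _ => c m)) => *; exact: one_unique.
move=> Y n x a.
have [z [zP z1]] := eP Y n (trivial_map Y n).
have [y [[y1 y0] yU]] := cP Y n a x.
have [t [[t1 t2] tU]] := wdP Y n z y (T1 _ _ _ _).
exists t; split.
  by rewrite -dh -dg !postc_comp t2.
move=> t' [ht' gt']; apply: tU; split.
  by apply: esym; apply: z1 => m ? ?; exact: one_unique.
by apply: esym; apply: yU; rewrite -!postc_comp dg dh.
Qed.

(** All auxiliary objects of a comma square can be chosen trivially: [1] is its own
    cotensor by [Delta 1] and its own square, and [D] serves as the product of
    [A] and [X]. *)
Lemma product_comma (K : cosmos) (A X D : K) (k : A ~> one) (b : X ~> one)
    (g : D ~> A) (h : D ~> X) :
  is_product h g -> exists lam : cell (b \oo h) (k \oo g), is_comma lam.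
Proof.
move=> hgP.
pose e : smap (Delta 1) (Map (@one K) one) :=
  @SMap (Delta 1) (Map (@one K) one) (fun m _ => degen m (idm one))
    (fun _ _ a _ => esym (degen_act a _)).
pose s : edge (b \oo h) (k \oo g) :=
  exist _ (degen 1 (b \oo h)) (conj (one_unique _ _) (one_unique _ _)).
exists (hoedge s).
exists one, one, D, e, (idm one), (idm one), g, h, (idm one), (bang D), (bang D), (idm D), s.
do ![split] => //; try exact: one_unique; try exact: compm1.
- move=> Y n x; have [z _] := @oneP K Y n.
  by exists z; split=> [m a u|? _]; exact: one_unique.
- move=> Y n x x'; exists x; split=> [|? _]; last exact: one_unique.
  by split; exact: one_unique.
- move=> Y n x x'; have [z [[z1 z2] zU]] := hgP Y n x' x.
  by exists z; split=> [//|z' [z1' z2']]; exact: zU.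
- move=> Y n x y _; exists y; split=> [|z [_ <-]].
    by split; [exact: one_unique|exact: comp1f].
  exact: comp1f.
Qed.

(** * Limits and pointwise right Kan extensions *)

Lemma transposeK (K : cosmos) (cc : cartesian_closed K) (A E : K) (f : A ~> E)
    (l : one ~> E) (mu : cell (l \oo bang A) f) :
  transpose (untranspose cc mu) = mu.
Proof.
apply: arr_inj; rewrite arr_cast arr_map arr_cast arr_map arrow_map_comp.
rewrite -[RHS]arrow_map_id; congr arrow_map; apply: smap_ext => n x.
have [_ o2] := one_prodP cc A.
by rewrite /= sfwdK -prec_comp o2 prec_id.
Qed.

Lemma bang_id_product (K : cosmos) (A : K) : is_product (bang A) (idm A).
Proof.
move=> Y n x a; exists a; split=> [|? [_ <-]]; last exact: comp1f.
by split; [exact: one_unique|exact: comp1f].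
Qed.

Theorem proposition5p3p4 (K : cosmos) (cc : cartesian_closed K) (A E : K) (f : A ~> E) :
  (forall (l : one ~> E)
      (nu : cell (const_diagram cc A E \oo l) (transp cc A E 0 f)),
    is_limit nu -> is_pointwise_right_kan (transpose nu)) /\
  (forall (l : one ~> E) (mu : cell (l \oo bang A) f),
    is_pointwise_right_kan mu -> is_limit (untranspose cc mu)).
Proof.
split=> [l nu nuP|l mu [_ muP] X p].
  split=> [|D X b g h lam /comma_product hgP]; last first.
    exact/(lifts_atP hgP (arr_paste (transpose nu) lam))/nuP.
  (* The square [1 <- A -> A] whiskers only by identities, but its right
     extension is of [f id] by [l id]; hence the casts. *)
  have el : l \oo idm one = l by exact: compm1.
  have em : (l \oo bang A) \oo idm A = (l \oo idm one) \oo bang A by rewrite el compm1.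
  apply: (right_extension_cast (mu := hocast em erefl (rwhisk (transpose nu) (idm A)))
    (f := f \oo idm A) el).
    rewrite arr_cast arr_rwhisk -[RHS]arrow_map_id; congr arrow_map.
    by apply: smap_ext => n x; exact: prec_id.
  apply/(lifts_atP (nu := nu) (@bang_id_product K A)); last exact: nuP.
  by rewrite arr_cast.
have [lam lamP] := product_comma (bang A) p (@prodP _ cc X A).
have em := arr_paste mu lam; rewrite -{2}(transposeK cc mu) in em.
by apply/(lifts_atP (@prodP _ cc X A) em)/muP.
Qed.
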